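(* Let $X$ be a metrizable topological space and let $h : X \to X$ be a homeomorphism of $X$ onto itself. Then there exists a metric $d$ on $X$, compatible with the topology of $X$, such that for every $k \in \mathbb{Z}\setminus\{0\}$ the homeomorphism $h^k$ satisfies the Lipschitz condition with respect to $d$ with a constant not exceeding $\log(|k|+2)$; that is, $d(h^k(x),h^k(y)) \leq \log(|k|+2)\, d(x,y)$ for all $x,y\in X$.
   Context: A metric on a metrizable space $X$ is compatible if it induces the given topology of $X$. For $k>0$, $h^k$ is the $k$-fold composition of $h$ with itself, and $h^{-k} = (h^{-1})^k$. $\log$ denotes the natural logarithm. *)

(* Defs.v *)
From HB Require Import structures.
From mathcomp Require Import all_boot all_order all_algebra.
From mathcomp Require Import all_classical all_reals all_analysis.

Set Implicit Arguments.
Unset Strict Implicit.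
Unset Printing Implicit Defensive.

Import Order.TTheory GRing.Theory Num.Theory.

Local Open Scope classical_set_scope.
Local Open Scope ring_scope.

(* The library's metricType attaches a single distance to a type and lets that
   distance define the topology. Here the topology of X is given and the
   distance varies, so metrics are plain functions X -> X -> R. *)
Record is_metric (R : realType) (X : Type) (d : X -> X -> R) : Prop := IsMetric {
  metric_ge0 : forall x y, 0 <= d x y;
  metric_eq0 : forall x y, d x y = 0 <-> x = y;
  metric_symm : forall x y, d x y = d y x;
  metric_triang : forall x y z, d x z <= d x y + d y z
}.

Definition compatible (R : realType) (X : topologicalType) (d : X -> X -> R) :
    Prop :=
  forall U : set X, open U <->
    (forall x, U x -> exists2 e : R, 0 < e & [set y | d x y < e] `<=` U).

Definition metrizable (R : realType) (X : topologicalType) : Prop :=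
  exists d : X -> X -> R, is_metric d /\ compatible d.

Record homeomorphism (X Y : topologicalType) := Homeomorphism {
  homeo_fun :> X -> Y;
  homeo_inv : Y -> X;
  homeo_funK : cancel homeo_fun homeo_inv;
  homeo_invK : cancel homeo_inv homeo_fun;
  homeo_fun_continuous : continuous homeo_fun;
  homeo_inv_continuous : continuous homeo_inv
}.

(* Negz n is the integer - n.+1. *)
Definition homeo_iter (X : topologicalType) (h : homeomorphism X X) (k : int) :
    X -> X :=
  match k with
  | Posz n => iter n h
  | Negz n => iter n.+1 (homeo_inv h)
  end.

(* Main.v *)
Require Import Defs.
From HB Require Import structures.
From mathcomp Require Import all_boot all_order all_algebra.
From mathcomp Require Import all_classical all_reals all_analysis.
From mathcomp Require Import lra zify.

(** Let [d0] be a compatible metric bounded by 1, and put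
    [d x y = sup_k d0 (h^k x) (h^k y) / c k] with [c k = ln (|k| + A)].
    Since [c] tends to infinity, only finitely many [k] matter up to a given
    error, so [d] induces the same topology as [d0]. Re-indexing the supremum
    shows that [h^m] has Lipschitz constant at most [sup_k c (k + m) / c k];
    this is at most [ln (|m| + 2)] once [A] is large, because [ln 3 > 1]. *)

Set Implicit Arguments.
Unset Strict Implicit.
Unset Printing Implicit Defensive.

Import Order.TTheory GRing.Theory Num.Theory.

Local Open Scope ring_scope.

(** * Inequalities for the natural logarithm *)

Lemma ln3_gt1 (R : realType) : 1 < ln (3 : R).
Proof.
(* 3 > (6/5)^6, and ln (6/5) >= 1/6 by concavity. *)
have h1 : ln (1 + - 6^-1 : R) <= - 6^-1 by apply: le_ln1Dx; lra.
have h2 : ln ((6 / 5) ^+ 6 : R) < ln 3.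
  by rewrite ltr_ln ?posrE; lra.
have h3 : ln ((6 / 5)^-1 : R) = - ln (6 / 5 : R) by rewrite lnV// posrE; lra.
have h4 : (1 + - 6^-1 : R) = (6 / 5)^-1 by rewrite invf_div; lra.
rewrite lnXn in h2; last by lra.
rewrite h4 h3 in h1.
lra.
Qed.

(** Comparing with [B + 1] gives [ln (B + m) <= ln B + B^-1 + ln (m + 2) - ln 3], which is at most
    [ln B + ln (m + 2) - 1]. A sum of two reals that are at least 1, minus 1, is at most their
    product. *)
Lemma ln_addr_le_mul (R : realType) (B m : R) :
  3 <= B -> B^-1 <= ln 3 - 1 -> 1 <= m -> ln (B + m) <= ln B * ln (m + 2).
Proof.
move=> B3 BV m1.
have lnB : 1 <= ln B.
  apply: (le_trans (ltW (ln3_gt1 R))); rewrite ler_ln ?posrE//; lra.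
have ln_B1 : ln (B + 1) <= ln B + B^-1.
  have -> : B + 1 = B * (1 + B^-1) by rewrite mulrDr mulr1 divff//; lra.
  have BV0 : 0 < B^-1 by rewrite invr_gt0; lra.
  rewrite lnM ?posrE ?lerD2l; [|lra|lra].
  by apply: le_ln1Dx; lra.
(* After exponentiation the two sides differ by [(B - 2) * (m - 1) >= 0]. *)
have ln_Bm : ln (B + m) + ln 3 <= ln (B + 1) + ln (m + 2).
  rewrite -!lnM ?posrE; [|lra..].
  rewrite ler_ln ?posrE; [nra|nra|nra].
have ln_m : ln 3 <= ln (m + 2) by rewrite ler_ln ?posrE; lra.
have l3 := ln3_gt1 R.
have : 0 <= (ln B - 1) * (ln (m + 2) - 1) by apply: mulr_ge0; lra.
nra.
Qed.

Lemma exists_ln_submultiplicative (R : realType) :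
  exists A : R, 3 <= A /\ forall B m : R, A <= B -> 1 <= m ->
    ln (B + m) <= ln B * ln (m + 2).
Proof.
have l3 := ln3_gt1 R.
have dV : 0 < (ln (3 : R) - 1)^-1 by rewrite invr_gt0; lra.
(* The second summand forces [B^-1 <= ln 3 - 1] for every [B >= A]. *)
exists (3 + (ln 3 - 1)^-1); split; first by lra.
move=> B m AB m1; apply: ln_addr_le_mul => //; first by lra.
by rewrite -[leRHS]invrK lef_pV2 ?posrE; lra.
Qed.

(** * Bounded metrics and neighbourhoods *)

Section Truncation.
Variables (R : realType) (X : topologicalType) (d : X -> X -> R).

Definition truncate_metric (x y : X) : R := Num.min (d x y) 1.

Lemma is_metric_truncate : is_metric d -> is_metric truncate_metric.
Proof.
case=> d0 deq ds dt; rewrite /truncate_metric; split=> [x y|x y|x y|x y z].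
- by rewrite le_min d0 ler01.
- split=> [|/deq ->]; last by rewrite min_l.
  by case: leP => _ => [/deq //|/eqP]; rewrite oner_eq0.
- by rewrite ds.
- have xz := dt x y z; have xy0 := d0 x y; have yz0 := d0 y z.
  by case: (leP (d x z)); case: (leP (d x y)); case: (leP (d y z)) => *; lra.
Qed.

Lemma compatible_truncate : compatible d -> compatible truncate_metric.
Proof.
move=> dc U; rewrite (dc U); split=> H x /H [e e0 eU].
(* Below radius 1 both metrics have the same balls. *)
- exists (Num.min e 1) => [|y /=]; first by rewrite lt_min e0 ltr01.
  rewrite lt_min !gt_min ltxx orbF => /andP[dxy d1]; apply: eU => /=.
  by case/orP: dxy => //; lra.
- by exists e => // y /= dxy; apply: eU => /=; rewrite gt_min dxy.
Qed.

End Truncation.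

(** [compatible] speaks of open sets only; the triangle inequality makes balls open. *)
Lemma compatible_nbhs_ball (R : realType) (X : topologicalType)
    (d : X -> X -> R) (x : X) (e : R) :
  is_metric d -> compatible d -> 0 < e -> nbhs x [set y | d x y < e]%classic.
Proof.
case=> d0 deq ds dt dc e0; apply: open_nbhs_nbhs; split => /=.
  apply/dc => y /= xy; exists (e - d x y) => [|z /= yz]; first by lra.
  by have := dt x y z; lra.
by have /deq -> := erefl x.
Qed.

(** * The action of the integers by iterates *)

Section HomeoIter.
Variables (X : topologicalType) (h : homeomorphism X X).

Lemma homeo_iterS (k : int) x : homeo_iter h (k + 1) x = h (homeo_iter h k x).
Proof.
case: k => [n|[|n]].
- by rewrite /= addn1.
- by rewrite /= homeo_invK.
- have -> : Negz n.+1 + 1 = Negz n by lia.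
  by rewrite /= homeo_invK.
Qed.

Lemma homeo_iterB1 (k : int) x :
  homeo_iter h (k - 1) x = homeo_inv h (homeo_iter h k x).
Proof. by rewrite -[in RHS](subrK 1 k) homeo_iterS homeo_funK. Qed.

Lemma homeo_iterD (k m : int) x :
  homeo_iter h (k + m) x = homeo_iter h k (homeo_iter h m x).
Proof.
elim: k => [|n IH|n IH]; first by rewrite add0r.
- by rewrite -addn1 PoszD addrAC !homeo_iterS IH.
- by rewrite -addn1 PoszD opprD addrAC !homeo_iterB1 IH.
Qed.

Lemma continuous_homeo_iter (k : int) : continuous (homeo_iter h k).
Proof.
elim: k => [|n IH|n IH] x; first exact: cvg_id.
- rewrite (_ : homeo_iter h n.+1 = h \o homeo_iter h n)//.
  exact: (continuous_comp (@IH x) (@homeo_fun_continuous _ _ h _)).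
- have -> : homeo_iter h (- n.+1%:Z) = homeo_inv h \o homeo_iter h (- n%:Z).
    by apply: funext => y; rewrite -addn1 PoszD opprD homeo_iterB1.
  exact: (continuous_comp (@IH x) (@homeo_inv_continuous _ _ h _)).
Qed.

End HomeoIter.

(** * The weighted supremum metric along orbits *)

Section OrbitMetric.
Variables (R : realType) (X : topologicalType) (h : homeomorphism X X).
Variables (d : X -> X -> R) (c : nat -> R).
Hypotheses (dm : is_metric d) (d_le1 : forall x y, d x y <= 1).
Hypothesis c_ge1 : forall n, 1 <= c n.

Let orbit_ratio x y (k : int) : R :=
  d (homeo_iter h k x) (homeo_iter h k y) / c `|k|%N.

Definition orbit_metric (x y : X) : R := sup (range (orbit_ratio x y)).

Let c_gt0 n : 0 < c n. Proof. by have := c_ge1 n; lra. Qed.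

(** The ratios are at most 1, since [d <= 1 <= c n], so the supremum is a genuine upper bound. *)
Lemma orbit_metric_ub k x y :
  d (homeo_iter h k x) (homeo_iter h k y) <= c `|k|%N * orbit_metric x y.
Proof.
rewrite mulrC -ler_pdivrMr//; apply: ub_le_sup; last by exists k.
exists 1 => _ [j _ <-]; rewrite ler_pdivrMr// mul1r.
exact: le_trans (d_le1 _ _) (c_ge1 _).
Qed.

Lemma orbit_metric_le x y e :
  (forall k, d (homeo_iter h k x) (homeo_iter h k y) <= e * c `|k|%N) ->
  orbit_metric x y <= e.
Proof.
move=> H; apply: ge_sup; first by exists (orbit_ratio x y 0); exists 0.
by move=> _ [k _ <-]; rewrite ler_pdivrMr.
Qed.

Lemma orbit_metric_ge0 x y : 0 <= orbit_metric x y.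
Proof.
(* Index 0 gives [d x y <= c 0 * orbit_metric x y]. *)
have := orbit_metric_ub 0 x y; have := metric_ge0 dm x y.
by move=> /le_trans /[apply]; rewrite pmulr_rge0.
Qed.

Lemma is_metric_orbit : is_metric orbit_metric.
Proof.
split=> [x y|x y|x y|x y z]; first exact: orbit_metric_ge0.
- split=> [D0|->].
    apply/(metric_eq0 dm)/eqP; rewrite eq_le metric_ge0// andbT.
    by have := orbit_metric_ub 0 x y; rewrite D0 mulr0.
  apply/eqP; rewrite eq_le orbit_metric_ge0 andbT.
  apply: orbit_metric_le => k; rewrite mul0r.
  by rewrite (metric_eq0 dm _ _).2.
- rewrite /orbit_metric; suff -> : orbit_ratio x y = orbit_ratio y x by [].
  by apply: funext => k; rewrite /orbit_ratio (metric_symm dm).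
- apply: orbit_metric_le => k.
  apply: le_trans (metric_triang dm _ (homeo_iter h k y) _) _.
  by rewrite mulrC mulrDr lerD ?orbit_metric_ub.
Qed.

Lemma compatible_orbit : compatible d ->
  (forall M, exists N, forall n, (N <= n)%N -> M <= c n) ->
  compatible orbit_metric.
Proof.
move=> dc c_infty U; split.
- move=> /dc H x /H [e e0 eU]; exists (e / c 0) => [|y /= xy].
    exact: divr_gt0.
  apply: eU => /=; apply: le_lt_trans (orbit_metric_ub 0 x y) _.
  by rewrite mulrC -ltr_pdivlMr.
- move=> H; rewrite openE => x /H [e e0 eU].
  (* A supremum of terms below a bound may attain it; halving [e] keeps the final inequality
     strict. *)
  have e20 : 0 < e / 2 by lra.
  (* For [|k| >= N] the bound [d <= 1 <= e / 2 * c |k|] holds for all [y]; the finitely many other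
     indices are handled by continuity. *)
  have [N cN] := c_infty (e / 2)^-1.
  suff nearN n : (\forall y \near x, forall k : int, (`|k| < n)%N ->
      d (homeo_iter h k x) (homeo_iter h k y) < e / 2).
    near=> y; apply: eU => /=.
    suff: orbit_metric x y <= e / 2 by lra.
    apply: orbit_metric_le => k; case: (ltnP `|k|%N N) => kN.
      have /ltW/le_trans -> // : d (homeo_iter h k x) (homeo_iter h k y) < e / 2.
        by move: k kN; near: y; exact: nearN.
      by rewrite ler_peMr// ltW.
    apply: le_trans (d_le1 _ _) _.
    by rewrite mulrC -ler_pdivrMr// mul1r cN.
  have near_iter (k : int) : \forall y \near x,
      d (homeo_iter h k x) (homeo_iter h k y) < e / 2.
    have := compatible_nbhs_ball (homeo_iter h k x) dm dc e20.
    exact: (@continuous_homeo_iter X h k x).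
  elim: n => [|n IH]; first by near=> y.
  near=> y => k; rewrite ltnS leq_eqVlt => /orP[/eqP kn|].
    (* Passing from [n] to [n.+1] adds only the indices [n] and [-n]. *)
    have [->|->] : k = n%:Z \/ k = - n%:Z by lia.
      by near: y; exact: near_iter.
    by near: y; exact: near_iter.
  by move: k; near: y.
Unshelve. all: by end_near.
Qed.

Lemma orbit_metric_lipschitz (m : int) (L : R) :
  (forall k : int, c `|(k + m)%R|%N <= L * c `|k|%N) ->
  forall x y, orbit_metric (homeo_iter h m x) (homeo_iter h m y)
    <= L * orbit_metric x y.
Proof.
move=> cL x y; apply: orbit_metric_le => k; rewrite -!homeo_iterD.
apply: le_trans (orbit_metric_ub _ _ _) _.
by rewrite mulrAC ler_wpM2r// orbit_metric_ge0.
Qed.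

End OrbitMetric.

Theorem theorem1p2 (R : realType) (X : topologicalType)
    (h : homeomorphism X X) :
  metrizable R X ->
  exists d : X -> X -> R,
    [/\ is_metric d,
        compatible d &
        forall k : int, k != 0 ->
          forall x y : X,
            d (homeo_iter h k x) (homeo_iter h k y)
              <= ln (`|k|%:~R + 2) * d x y].
Proof.
case=> d0 [/is_metric_truncate dm /compatible_truncate dc].
have [A [A3 lnA]] := exists_ln_submultiplicative R.
have l3 := ln3_gt1 R.
pose c (n : nat) : R := ln (n%:R + A).
have c_ge1 n : 1 <= c n.
  apply: (le_trans (ltW l3)); have := ler0n R n => n0.
  by rewrite ler_ln ?posrE; lra.
have d_le1 x y : truncate_metric d0 x y <= 1 by rewrite ge_min lexx orbT.
exists (orbit_metric h (truncate_metric d0) c); split.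
- exact: is_metric_orbit.
- apply: compatible_orbit => // M.
  exists (Num.truncn (expR M)).+1 => n Mn.
  rewrite -[M]expRK ler_ln ?posrE ?expR_gt0//; last first.
    by have := ler0n R n; lra.
  have := truncnS_gt (expR M); have : (Num.truncn (expR M)).+1%:R <= n%:R :> R.
    by rewrite ler_nat.
  lra.
- move=> k k0; apply: orbit_metric_lipschitz => // j.
  rewrite -natr_absz.
  have k1 : 1 <= `|k|%N%:R :> R by rewrite ler1n absz_gt0.
  have j0 := ler0n R `|j|%N.
  have jk : `|(j + k)%R|%N%:R <= `|j|%N%:R + `|k|%N%:R :> R.
    by rewrite -natrD ler_nat; lia.
  have jk0 := ler0n R `|(j + k)%R|%N.
  (* The logarithmic inequality with [B = |j| + A] and [m = |k|]; what remains is
     [|j + k| + A <= B + m]. *)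
  rewrite mulrC; apply: le_trans (lnA (`|j|%N%:R + A) _ _ k1); last by lra.
  by rewrite ler_ln ?posrE; lra.
Qed.
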